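(* Let $R$ be a connected quotient root system with base $S$ and let $\Phi \subseteq R^+$. Then $\Phi = \inf_I^S(\Psi, X)$ for some proper subset $I \subsetneq S$, some $\Psi\subseteq (R/I)^+$ and some $X\subseteq R_I^+$, where exactly one of the following mutually exclusive alternatives holds: (i) $\Psi$ is primitive (as a subset of the positive roots of the quotient root system $R/I$); or (ii) $\Psi = \emptyset$ or $\Psi = (R/I)^+$, and $I$ is the smallest subset of $S$ (with respect to inclusion) with this property. Moreover, this decomposition (i.e. $I$, $\Psi$ and $X$) is unique.
   Context: Quotient root systems (QRS): let $\Delta$ be a root system in a Euclidean space $E$ with base $\Sigma$. For $J \subsetneq \Sigma$ identify $E/\mathrm{span}\,J$ with the orthogonal complement of $\mathrm{span}\,J$ (with induced inner product $\langle\cdot,\cdot\rangle$) and let $\pi_J$ be the projection; the QRS $\Delta/J$ is the set $\{\pi_J(\beta) : \beta \in \Delta \setminus \mathrm{span}\,J\}$ (its elements are called roots). A QRS $R$ has a base $S$ (the images of $\Sigma\setminus J$), a basis of the ambient space such that every root is an integer combination of $S$ with all coefficients $\ge 0$ (positive roots, $R^+$) or all $\le 0$. $R$ is connected if the graph on $S$ with an edge between $\theta,\theta'$ iff $\langle\theta,\theta'\rangle<0$ is connected. For $K \subseteq S$: $R_K = R \cap \mathrm{span}\,K$ (a QRS with base $K$), $R_K^+ = R_K \cap R^+$; $\pi_K$ denotes orthogonal projection onto $(\mathrm{span}\,K)^\perp$, $R/K$ is the set of non-zero elements of $\pi_K(R)$, a QRS with base the images of $S\setminus K$ and positive roots $(R/K)^+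 = \pi_K(R^+)\setminus\{0\}$. Inflation: for $K\subseteq S$, $\Psi\subseteq (R/K)^+$, $X \subseteq R_K^+$, $\inf_K^S(\Psi,X) := \{\alpha\in R^+ : \pi_K(\alpha)\in\Psi\} \cup X$. A subset $\Phi\subseteq R^+$ is primitive if $\Phi\ne\emptyset$, $\Phi\ne R^+$, and $\Phi = \inf_K^S(\Psi,X)$ for some $\Psi,X$ implies $K=\emptyset$ or $K=S$; the same notion applies inside any QRS, in particular inside $R/I$ with its base. *)

(* Defs.v *)
From HB Require Import structures.
From mathcomp Require Import all_boot all_order all_algebra.
From mathcomp Require Import boolp classical_sets reals.
Set Implicit Arguments. Unset Strict Implicit. Unset Printing Implicit Defensive.
Import Order.TTheory GRing.Theory Num.Theory.
Local Open Scope ring_scope.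
Local Open Scope classical_set_scope.

(* The Euclidean space E is modelled as R^n = 'rV[R]_n with the standard
   inner product.  Quotients E / span J are identified with the orthogonal
   complement of span J inside R^n (with the induced inner product), so all
   roots of all quotient root systems live in 'rV[R]_n. *)

Definition dotv (R : realType) (n : nat) (u v : 'rV[R]_n) : R :=
  \sum_(i < n) u ord0 i * v ord0 i.

Definition fin_set (T : eqType) (A : set T) : Prop :=
  exists s : seq T, forall x, A x <-> x \in s.

Definition span (R : realType) (n : nat) (A : set 'rV[R]_n) : set 'rV[R]_n :=
  [set v | exists (s : seq 'rV[R]_n) (c : 'rV[R]_n -> R),
      (forall x, x \in s -> A x) /\ v = \sum_(x <- s) c x *: x].

Definition lin_indep (R : realType) (n : nat) (A : set 'rV[R]_n) : Prop :=
  forall (s : seq 'rV[R]_n) (c : 'rV[R]_n -> R),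
    uniq s -> (forall x, x \in s -> A x) ->
    \sum_(x <- s) c x *: x = 0 -> forall x, x \in s -> c x = 0.

Definition nonneg_int_comb (R : realType) (n : nat) (S : set 'rV[R]_n)
    (v : 'rV[R]_n) : Prop :=
  exists (s : seq 'rV[R]_n) (c : 'rV[R]_n -> nat),
    (forall x, x \in s -> S x) /\ v = \sum_(x <- s) (c x)%:R *: x.

Definition orth (R : realType) (n : nat) (K : set 'rV[R]_n) : set 'rV[R]_n :=
  [set w | forall k, K k -> dotv k w = 0].

Definition proj (R : realType) (n : nat) (K : set 'rV[R]_n) (v : 'rV[R]_n)
    : 'rV[R]_n :=
  xget 0 [set w | orth K w /\ span K (v - w)].

Definition reflect_in (R : realType) (n : nat) (a b : 'rV[R]_n) : 'rV[R]_n :=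
  b - (2 * dotv b a / dotv a a) *: a.

Definition root_system (R : realType) (n : nat) (D : set 'rV[R]_n) : Prop :=
  [/\ fin_set D, span D = setT, ~ D 0,
      (forall a b, D a -> D b -> D (reflect_in a b)) /\
      (forall a b, D a -> D b -> exists z : int, 2 * dotv b a / dotv a a = z%:~R)
    & (forall a (c : R), D a -> D (c *: a) -> c = 1 \/ c = -1)].

Definition base_of (R : realType) (n : nat) (D Sg : set 'rV[R]_n) : Prop :=
  [/\ Sg `<=` D, lin_indep Sg, span Sg = setT
    & forall a, D a -> nonneg_int_comb Sg a \/ nonneg_int_comb Sg (- a)].

Definition is_QRS (R : realType) (n : nat) (Rt S : set 'rV[R]_n) : Prop :=
  exists D Sg J : set 'rV[R]_n,
    [/\ root_system D, base_of D Sg, J `<=` Sg /\ J <> Sg,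
        Rt = proj J @` (D `\` span J)
      & S = proj J @` (Sg `\` J)].

Definition QRS_connected (R : realType) (n : nat) (S : set 'rV[R]_n) : Prop :=
  forall a b, S a -> S b ->
    exists p : seq 'rV[R]_n, (forall x, x \in p -> S x) /\
      path (fun x y => dotv x y < 0) a p /\ last a p = b.

Definition pos_roots (R : realType) (n : nat) (Rt S : set 'rV[R]_n)
    : set 'rV[R]_n :=
  [set a | Rt a /\ nonneg_int_comb S a].

Definition sub_roots (R : realType) (n : nat) (Rt K : set 'rV[R]_n) :=
  Rt `&` span K.
Definition sub_pos_roots (R : realType) (n : nat) (Rt S K : set 'rV[R]_n) :=
  pos_roots Rt S `&` span K.

Definition quot_roots (R : realType) (n : nat) (Rt K : set 'rV[R]_n)
    : set 'rV[R]_n :=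
  [set v | v <> 0 /\ exists a, Rt a /\ proj K a = v].
Definition quot_base (R : realType) (n : nat) (S K : set 'rV[R]_n)
    : set 'rV[R]_n :=
  proj K @` (S `\` K).
Definition quot_pos_roots (R : realType) (n : nat) (Rt S K : set 'rV[R]_n)
    : set 'rV[R]_n :=
  [set v | v <> 0 /\ exists a, pos_roots Rt S a /\ proj K a = v].

Definition inflation (R : realType) (n : nat) (Rt S K Psi X : set 'rV[R]_n)
    : set 'rV[R]_n :=
  [set a | pos_roots Rt S a /\ Psi (proj K a)] `|` X.

Definition primitive (R : realType) (n : nat) (Rt S Phi : set 'rV[R]_n) : Prop :=
  [/\ Phi <> set0, Phi <> pos_roots Rt S
    & forall K Psi X : set 'rV[R]_n,
        K `<=` S -> Psi `<=` quot_pos_roots Rt S K -> X `<=` sub_pos_roots Rt S K ->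
        Phi = inflation Rt S K Psi X -> K = set0 \/ K = S].

Definition decomp_alt_i (R : realType) (n : nat) (Rt S I Psi : set 'rV[R]_n) :=
  primitive (quot_roots Rt I) (quot_base S I) Psi.

Definition decomp_alt_ii (R : realType) (n : nat) (Rt S Phi I Psi : set 'rV[R]_n) :=
  (Psi = set0 \/ Psi = quot_pos_roots Rt S I) /\
  (forall I' Psi' X' : set 'rV[R]_n,
      I' `<=` S -> (Psi' = set0 \/ Psi' = quot_pos_roots Rt S I') ->
      X' `<=` sub_pos_roots Rt S I' ->
      Phi = inflation Rt S I' Psi' X' -> I `<=` I').

Definition good_decomp (R : realType) (n : nat) (Rt S Phi I Psi X : set 'rV[R]_n)
    : Prop :=
  [/\ I `<=` S /\ I <> S, Psi `<=` quot_pos_roots Rt S I,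
      X `<=` sub_pos_roots Rt S I, Phi = inflation Rt S I Psi X
    & (decomp_alt_i Rt S I Psi \/ decomp_alt_ii Rt S Phi I Psi) /\
      ~ (decomp_alt_i Rt S I Psi /\ decomp_alt_ii Rt S Phi I Psi)].

(* Main.v *)
Require Import Defs.
From HB Require Import structures.
From mathcomp Require Import all_boot all_order all_algebra archimedean.
From mathcomp Require Import boolp classical_sets reals.
From mathcomp Require Import zify ring lra.
(* Restores [Defs.span], hidden by the homonym of [vector]. *)
Import Defs.
Set Implicit Arguments. Unset Strict Implicit. Unset Printing Implicit Defensive.
Import Order.TTheory GRing.Theory Num.Theory.
Local Open Scope ring_scope.
Local Open Scope classical_set_scope.

(* A subset [Phi] of the positive roots is an inflation from [K] iff it is a
   union of fibres of [proj K] outside [span K]. Roots in a quotient root system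
   with negative inner product have a sum that is a root or [0]; hence two
   positive roots in the same fibre of [proj K] are joined by a path of positive
   roots in that fibre whose steps are simple roots of [K]. So [Phi] is an
   inflation from [K] iff its membership is unchanged by adding elements of [K]
   outside [span K], a condition that is preserved by unions. If [Phi] is an
   inflation from [I] with a primitive quotient part, then [I] is maximal among
   the proper subsets from which [Phi] is an inflation; any other such [K] not
   contained in [I] satisfies [I `|` K = S], and connectedness then produces
   some [a] outside [I] such that [Phi] has a trivial quotient part at
   [S `\ a], a contradiction. Subsets with trivial quotient part are closed
   under intersection, because a root of full support forces all proper ones to
   have the same kind of triviality. *)

(** * Orthogonal projections and coordinates *)

Section InnerProduct.
Variables (R : realType) (n : nat).
Implicit Types (u v w x y a b k : 'rV[R]_n) (A B K S : set 'rV[R]_n).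

Lemma dotvC u v : dotv u v = dotv v u.
Proof. by apply: eq_bigr => i _; rewrite mulrC. Qed.

Lemma dotvDl u v w : dotv (u + v) w = dotv u w + dotv v w.
Proof. by rewrite -big_split; apply: eq_bigr => i _; rewrite mxE mulrDl. Qed.

Lemma dotvZl (c : R) u w : dotv (c *: u) w = c * dotv u w.
Proof. by rewrite mulr_sumr; apply: eq_bigr => i _; rewrite mxE mulrA. Qed.

Lemma dotvDr u v w : dotv w (u + v) = dotv w u + dotv w v.
Proof. by rewrite !(dotvC w) dotvDl. Qed.

Lemma dotvZr (c : R) u w : dotv w (c *: u) = c * dotv w u.
Proof. by rewrite !(dotvC w) dotvZl. Qed.

Lemma dotv0l w : dotv 0 w = 0.
Proof. by rewrite -(scale0r 0) dotvZl mul0r. Qed.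

Lemma dotv0r w : dotv w 0 = 0.
Proof. by rewrite dotvC dotv0l. Qed.

Lemma dotvNl u w : dotv (- u) w = - dotv u w.
Proof. by rewrite -scaleN1r dotvZl mulN1r. Qed.

Lemma dotvNr u w : dotv w (- u) = - dotv w u.
Proof. by rewrite dotvC dotvNl dotvC. Qed.

Lemma dotvBl u v w : dotv (u - v) w = dotv u w - dotv v w.
Proof. by rewrite dotvDl dotvNl. Qed.

Lemma dotvBr u v w : dotv w (u - v) = dotv w u - dotv w v.
Proof. by rewrite dotvDr dotvNr. Qed.

Lemma dotv_suml (T : Type) (s : seq T) (P : pred T) (F : T -> 'rV[R]_n) w :
  dotv (\sum_(i <- s | P i) F i) w = \sum_(i <- s | P i) dotv (F i) w.
Proof.
apply: (big_morph (fun u => dotv u w)) => [u v|]; [exact: dotvDl | exact: dotv0l].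
Qed.

Lemma dotvv_ge0 u : 0 <= dotv u u.
Proof. by apply: sumr_ge0 => i _; rewrite -expr2 sqr_ge0. Qed.

Lemma dotvv_eq0 u : dotv u u = 0 -> u = 0.
Proof.
move=> /eqP; rewrite psumr_eq0; last by move=> i _; rewrite -expr2 sqr_ge0.
move=> /allP H; apply/rowP => i; rewrite mxE.
by have := H i (mem_index_enum i); rewrite -expr2 sqrf_eq0 => /eqP.
Qed.

Lemma span_ind A (P : 'rV[R]_n -> Prop) :
  P 0 -> (forall c x v, A x -> P v -> P (c *: x + v)) ->
  forall v, span A v -> P v.
Proof.
move=> P0 PD v [s [c [sA ->]]]; elim: s sA => [|x s IH] sA; first by rewrite big_nil.
rewrite big_cons; apply: PD; first by apply: sA; rewrite mem_head.
by apply: IH => y ys; apply: sA; rewrite in_cons ys orbT.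
Qed.

Lemma span0 A : span A 0.
Proof. by exists [::], (fun=> 0); rewrite big_nil. Qed.

(** Lists in [span] may repeat vectors. Absorbing multiplicities into the coefficients moves
    combinations onto one duplicate-free list, where two different coefficient functions can be
    added. *)
Lemma big_count_scale (t s : seq 'rV[R]_n) (c : 'rV[R]_n -> R) :
  uniq t -> {subset s <= t} ->
  \sum_(x <- s) c x *: x = \sum_(x <- t) (c x *+ count_mem x s) *: x.
Proof.
move=> ut; elim: s => [|y s IH] st.
  by rewrite big_nil big1 // => x _; rewrite scale0r.
rewrite big_cons IH; last by move=> x xs; apply: st; rewrite in_cons xs orbT.
under [RHS]eq_bigr => x _ do rewrite /= mulrnDr scalerDl.
rewrite big_split /=; congr (_ + _).
rewrite (bigD1_seq y) ?st ?mem_head //= eqxx big1 ?addr0 // => x /negbTE yx.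
by rewrite eq_sym yx scale0r.
Qed.

Lemma spanD A u v : span A u -> span A v -> span A (u + v).
Proof.
move=> [s1 [c1 [h1 ->]]] [s2 [c2 [h2 ->]]].
set t := undup (s1 ++ s2); have ut : uniq t := undup_uniq _.
rewrite (@big_count_scale t s1) ?(@big_count_scale t s2) //;
  try by move=> x xs; rewrite mem_undup mem_cat xs ?orbT.
exists t, (fun x => c1 x *+ count_mem x s1 + c2 x *+ count_mem x s2); split.
  by move=> x; rewrite mem_undup mem_cat => /orP[/h1|/h2].
by rewrite -big_split; apply: eq_bigr => x _; rewrite scalerDl.
Qed.

Lemma spanZ A (c : R) v : span A v -> span A (c *: v).
Proof.
move=> [s [d [sA ->]]]; exists s, (fun x => c * d x); split=> //.
by rewrite scaler_sumr; apply: eq_bigr => x _; rewrite scalerA.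
Qed.

Lemma spanN A v : span A v -> span A (- v).
Proof. by rewrite -scaleN1r; apply: spanZ. Qed.

Lemma spanB A u v : span A u -> span A v -> span A (u - v).
Proof. by move=> Au /spanN; apply: spanD. Qed.

Lemma mem_span A x : A x -> span A x.
Proof.
move=> Ax; exists [:: x], (fun=> 1); split; last by rewrite big_seq1 scale1r.
by move=> y; rewrite inE => /eqP ->.
Qed.

Lemma span_sub A B : A `<=` span B -> span A `<=` span B.
Proof.
move=> AB; apply: span_ind => [|c x v /AB Bx Bv]; first exact: span0.
by apply: spanD => //; apply: spanZ.
Qed.

Lemma spanS A B : A `<=` B -> span A `<=` span B.
Proof. by move=> AB; apply: span_sub => x /AB /mem_span. Qed.

Lemma span_set0 v : span set0 v -> v = 0.
Proof. by move: v; apply: span_ind. Qed.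

Lemma orth_span K w v : orth K w -> span K v -> dotv v w = 0.
Proof.
move=> Kw; move: v; apply: span_ind => [|c x v /Kw xw vw]; first exact: dotv0l.
by rewrite dotvDl dotvZl xw vw mulr0 addr0.
Qed.

Lemma orthB K u v : orth K u -> orth K v -> orth K (u - v).
Proof. by move=> Ku Kv k Kk; rewrite dotvBr Ku // Kv // subrr. Qed.

Lemma orth_span_eq0 K w : orth K w -> span K w -> w = 0.
Proof. by move=> ow /(orth_span ow) /dotvv_eq0. Qed.

(** One Gram-Schmidt step per vector: [p] is the part of [k] orthogonal to the earlier vectors, and
    the component of [w] along [p] is removed. *)
Lemma orth_decomp (s : seq 'rV[R]_n) v :
  exists w, orth [set` s] w /\ span [set` s] (v - w).
Proof.
elim: s v => [|k s IH] v; first by exists v; rewrite subrr; split=> //; exact: span0.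
have [p [op sp]] := IH k; have [w [ow sw]] := IH v.
have sub : span [set` s] `<=` span [set` k :: s].
  by apply: spanS => x /= xs; rewrite in_cons xs orbT.
have kk : span [set` k :: s] k by apply: mem_span; rewrite /= mem_head.
have sp' : span [set` k :: s] p.
  by rewrite -(subKr k p); apply: spanB => //; apply: sub.
pose c := dotv w p / dotv p p.
exists (w - c *: p); split; last first.
  by rewrite opprB addrCA; apply: spanD; [exact: spanZ|exact: sub].
have op' : orth [set` s] (w - c *: p).
  by move=> x xs; rewrite dotvBr dotvZr ow // op // mulr0 subr0.
move=> x /=; rewrite in_cons => /orP[/eqP ->|]; last exact: op'.
rewrite -(subrK p k) dotvDl (orth_span op') // add0r dotvBr dotvZr /c dotvC.
(* When [p] is [0] the quotient [c] divides by zero, but every product with [p] vanishes. *)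
have [p0|/eqP p0] := pselect (dotv p p = 0).
  by rewrite (dotvv_eq0 p0) !dotv0r mulr0 subr0.
by rewrite divfK // subrr.
Qed.

Lemma fin_set_sub A B : A `<=` B -> fin_set B -> fin_set A.
Proof.
move=> AB [s sE]; exists [seq x <- s | `[< A x >]] => x.
rewrite mem_filter; split=> [Ax|/andP[/asboolP]//].
by apply/andP; split; [exact/asboolP|exact/sE/AB].
Qed.

Lemma fin_set_image A (f : 'rV[R]_n -> 'rV[R]_n) : fin_set A -> fin_set (f @` A).
Proof.
move=> [s sE]; exists (map f s) => x; split=> [[a /sE As <-]|/mapP[a /sE Aa ->]].
  exact: map_f.
by exists a.
Qed.

(** * Orthogonal projection along the span of a finite set *)

Section Projection.
Variable K : set 'rV[R]_n.
Hypothesis finK : fin_set K.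

(** Gram-Schmidt supplies a witness for finite [K], so [xget] does not fall back on its default
    [0]. *)
Lemma projP v : orth K (proj K v) /\ span K (v - proj K v).
Proof.
have [s sE] := finK.
have -> : K = [set` s] by apply/seteqP; split=> x /sE.
have [w wP] := orth_decomp s v; by rewrite /proj; case: xgetP => [x _ []|/(_ w)].
Qed.

Lemma orth_proj v : orth K (proj K v). Proof. by case: (projP v). Qed.

Lemma span_subproj v : span K (v - proj K v). Proof. by case: (projP v). Qed.

(** Two candidates differ by a vector that is both in [span K] and orthogonal to [K], hence by
    [0]. *)
Lemma proj_uniq v w : orth K w -> span K (v - w) -> proj K v = w.
Proof.
have [op sp] := projP v => ow sw; apply/eqP; rewrite -subr_eq0; apply/eqP.
apply: (@orth_span_eq0 K); first exact: orthB.
have -> : proj K v - w = (v - w) - (v - proj K v) by rewrite opprB [RHS]addrC addrA subrK.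
exact: spanB.
Qed.

Lemma proj_eq u v : proj K u = proj K v <-> span K (u - v).
Proof.
have [ou su] := projP u; have [ov sv] := projP v; split=> [uv|suv].
  have -> : u - v = (u - proj K u) - (v - proj K v).
    by rewrite uv opprB addrA subrK.
  exact: spanB.
apply: proj_uniq => //.
have -> : u - proj K v = (u - v) + (v - proj K v) by rewrite addrA subrK.
exact: spanD.
Qed.

Lemma proj_eq0 v : proj K v = 0 <-> span K v.
Proof.
have p0 : proj K 0 = 0.
  by apply: proj_uniq => [k _|]; rewrite ?dotv0r // subr0; exact: span0.
by rewrite -p0 proj_eq subr0.
Qed.

Lemma projD u v : proj K (u + v) = proj K u + proj K v.
Proof.
have [ou su] := projP u; have [ov sv] := projP v.
apply: proj_uniq => [k Kk|]; first by rewrite dotvDr ou // ov // addr0.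
by rewrite opprD addrACA; apply: spanD.
Qed.

Lemma projZ c v : proj K (c *: v) = c *: proj K v.
Proof.
have [ov sv] := projP v.
apply: proj_uniq => [k Kk|]; first by rewrite dotvZr ov // mulr0.
by rewrite -scalerBr; apply: spanZ.
Qed.

Lemma projN v : proj K (- v) = - proj K v.
Proof. by rewrite -scaleN1r projZ scaleN1r. Qed.

End Projection.

Lemma proj_set0 v : proj set0 v = v.
Proof. by apply: proj_uniq => //; [exists [::]|rewrite subrr; exact: span0]. Qed.

(** * Coordinate forms dual to a base *)

Section DualCoordinates.
Variables (S : set 'rV[R]_n) (cf : 'rV[R]_n -> {scalar 'rV[R]_n}).
Hypothesis cfE : forall x y, S x -> S y -> cf x y = (x == y)%:R.

Lemma cf_span K x v : K `<=` S -> S x -> ~ K x -> span K v -> cf x v = 0.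
Proof.
move=> KS Sx nKx; move: v; apply: span_ind => [|c y v Ky v0]; first exact: linear0.
rewrite linearP v0 addr0 cfE //; last exact: KS.
by case: eqP Ky => [<- /nKx//|_ _]; exact: mulr0.
Qed.

(** A vector of [span S] equals its coordinate expansion; dropping the zero terms leaves only
    vectors of [K]. *)
Lemma span_cfP (s : seq 'rV[R]_n) K v : uniq s -> (forall x, S x <-> x \in s) ->
  K `<=` S -> span S v -> (span K v <-> forall x, S x -> ~ K x -> cf x v = 0).
Proof.
move=> us sE KS Sv.
have vE : v = \sum_(x <- s) cf x v *: x.
  move: v Sv; apply: span_ind => [|c y v Sy vE].
    by rewrite big1 // => x _; rewrite linear0 scale0r.
  under eq_bigr => x _ do rewrite linearP scalerDl.
  rewrite big_split -vE /=; congr (_ + _).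
  rewrite (bigD1_seq y) //=; last exact/sE.
  rewrite cfE // eqxx mulr1 big_seq_cond big1 ?addr0 // => x /andP[/sE Sx /negbTE xy].
  by rewrite cfE // xy mulr0 scale0r.
split=> [Kv x Sx nKx|v0]; first exact: (cf_span KS).
rewrite vE; exists [seq x <- s | `[< K x >]], (fun x => cf x v); split.
  by move=> x; rewrite mem_filter => /andP[/asboolP].
rewrite big_filter (bigID (fun x => `[< K x >])) /= [X in _ + X]big_seq_cond.
rewrite [X in _ + X]big1 ?addr0 // => x /andP[/sE Sx /asboolPn nK].
by rewrite v0 // scale0r.
Qed.

End DualCoordinates.

Lemma lin_indep_dual S : fin_set S -> lin_indep S ->
  exists cf : 'rV[R]_n -> {scalar 'rV[R]_n},
    forall x y, S x -> S y -> cf x y = (x == y)%:R.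
Proof.
move=> [s0 s0E] indep; pose s := undup s0.
have sE x : S x <-> x \in s by rewrite s0E mem_undup.
have us : uniq s := undup_uniq _.
pose X := in_tuple s.
have fX : free X.
  apply/freeP => k k0 i.
  (* [lin_indep] indexes coefficients by vectors, [freeP] by positions; since [s] has no
     repetitions, the sum at an entry of [s] has a single term. *)
  pose c x := \sum_(j < size s | s`_j == x) k j.
  have cE (j : 'I_(size s)) : c s`_j = k j.
    rewrite /c (bigD1 j) //= big1 ?addr0 // => l /andP[].
    by rewrite nth_uniq // => /eqP/val_inj ->; rewrite eqxx.
  rewrite -cE; apply: (indep s) => //; first by move=> x /sE.
    rewrite (big_nth 0) big_mkord -[RHS]k0; apply: eq_bigr => j _.
    by rewrite cE.
  exact: mem_nth.
have h x : exists f : {scalar 'rV[R]_n}, S x -> forall y, S y -> f y = (x == y)%:R.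
  case: (pselect (S x)) => [Sx|nSx]; last first.
    by exists (\0 : {scalar 'rV[R]_n}) => Sx.
  have /sE xs := Sx; have xi : (index x s < size s)%N by rewrite index_mem.
  exists (coord X (Ordinal xi)) => _ y /sE ys.
  have yi : (index y s < size s)%N by rewrite index_mem.
  have {1}<- : X`_(Ordinal yi) = y by rewrite /= nth_index.
  rewrite [LHS]coord_free // eq_sym; congr (nat_of_bool _)%:R.
  apply/eqP/eqP => [[]|xy]; last by apply: val_inj; rewrite /= xy.
  by move=> /(congr1 (nth 0 s)); rewrite !nth_index.
by have [cf cfE] := choice h; exists cf => x y Sx; apply: cfE.
Qed.

Lemma nonneg_int_comb_ind S (P : 'rV[R]_n -> Prop) :
  P 0 -> (forall (m : nat) x v, S x -> P v -> P (m%:R *: x + v)) ->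
  forall v, nonneg_int_comb S v -> P v.
Proof.
move=> P0 PD v [s [c [sA ->]]]; elim: s sA => [|x s IH] sA; first by rewrite big_nil.
rewrite big_cons; apply: PD; first by apply: sA; rewrite mem_head.
by apply: IH => y ys; apply: sA; rewrite in_cons ys orbT.
Qed.

Lemma nonneg_int_comb0 S : nonneg_int_comb S 0.
Proof. by exists [::], (fun=> 0%N); rewrite big_nil. Qed.

Lemma nonneg_int_combD S u v :
  nonneg_int_comb S u -> nonneg_int_comb S v -> nonneg_int_comb S (u + v).
Proof.
move=> [s1 [c1 [h1 ->]]] [s2 [c2 [h2 ->]]].
set t := undup (s1 ++ s2); have ut : uniq t := undup_uniq _.
rewrite (@big_count_scale t s1) ?(@big_count_scale t s2) //;
  try by move=> x xs; rewrite mem_undup mem_cat xs ?orbT.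
exists t, (fun x => c1 x * count_mem x s1 + c2 x * count_mem x s2)%N; split.
  by move=> x; rewrite mem_undup mem_cat => /orP[/h1|/h2].
rewrite -big_split; apply: eq_bigr => x _.
by rewrite natrD !natrM !mulr_natr scalerDl.
Qed.

Lemma nonneg_int_combZ S (m : nat) x : S x -> nonneg_int_comb S (m%:R *: x).
Proof.
move=> Sx; exists [:: x], (fun=> m); split; last by rewrite big_seq1.
by move=> y; rewrite inE => /eqP ->.
Qed.

End InnerProduct.

(** * Paths of positive roots *)

Section SimpleRoots.
Variables (R : realType) (n : nat) (Rt S : set 'rV[R]_n).
Variables (sS : seq 'rV[R]_n) (cf : 'rV[R]_n -> {scalar 'rV[R]_n}).
Hypotheses (uS : uniq sS) (sSE : forall x, S x <-> x \in sS).
Hypothesis cfE : forall x y, S x -> S y -> cf x y = (x == y)%:R.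
Hypothesis simple_root : S `<=` Rt.
Hypothesis root_comb :
  forall a, Rt a -> nonneg_int_comb S a \/ nonneg_int_comb S (- a).
Hypothesis root_neq0 : ~ Rt 0.
Hypothesis rootN : forall a, Rt a -> Rt (- a).
Hypothesis root_add :
  forall a b, Rt a -> Rt b -> dotv a b < 0 -> a + b = 0 \/ Rt (a + b).
Implicit Types (u v w x y a b c k : 'rV[R]_n) (K U T : set 'rV[R]_n).

Local Notation pos := (pos_roots Rt S).

Lemma comb_span v : nonneg_int_comb S v -> span S v.
Proof.
by move=> [s [c [sA ->]]]; exists s, (fun x => (c x)%:R).
Qed.

Lemma comb_cf v x : nonneg_int_comb S v -> S x -> cf x v \is a Num.nat.
Proof.
move=> vS Sx; move: v vS; apply: nonneg_int_comb_ind; first by rewrite linear0.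
move=> m y v Sy vN; rewrite linearP cfE //=.
by rewrite rpredD // rpredM // natr_nat.
Qed.

Lemma root_span a : Rt a -> span S a.
Proof.
move=> /root_comb[/comb_span//|/comb_span/spanN]; by rewrite opprK.
Qed.

Lemma root_int a x : Rt a -> S x -> cf x a \is a Num.int.
Proof.
move=> /root_comb[/comb_cf h|/comb_cf h] Sx; first by rewrite intr_nat ?h.
by rewrite -rpredN -linearN intr_nat ?h.
Qed.

Lemma cf_inj v : span S v -> (forall x, S x -> cf x v = 0) -> v = 0.
Proof.
move=> Sv v0; apply: span_set0.
by apply/(span_cfP cfE uS sSE) => // x Sx _; apply: v0.
Qed.

Lemma pos_cf a x : pos a -> S x -> 0 <= cf x a.
Proof. by move=> [_ aS] Sx; apply: natr_ge0; apply: comb_cf. Qed.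

(** If [- a] were the nonnegative combination, all coordinates of [a] would vanish and the root [a]
    would be [0]. *)
Lemma posP a : pos a <-> Rt a /\ forall x, S x -> 0 <= cf x a.
Proof.
split=> [pa|[Ra a0]]; first by split=> [|x]; [case: pa|exact: pos_cf].
split=> //; case: (root_comb Ra) => // Na; case: root_neq0.
rewrite -(_ : a = 0) //; apply: cf_inj => [|x Sx]; first exact: root_span.
apply/eqP; rewrite eq_le a0 // andbT -oppr_ge0 -linearN.
by apply: natr_ge0; apply: comb_cf.
Qed.

Lemma root_sub a b : Rt a -> Rt b -> 0 < dotv a b -> a - b = 0 \/ Rt (a - b).
Proof. by move=> Ra /rootN Rb ab; apply: root_add; rewrite // dotvNr oppr_lt0. Qed.

(** Otherwise [x - y] would be a root with coordinates of both signs, [1] at [x] and [-1] at [y]. *)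
Lemma simple_obtuse x y : S x -> S y -> x <> y -> dotv x y <= 0.
Proof.
move=> Sx Sy xy; rewrite leNgt; apply/negP => d0.
have [/subr0_eq//|] := root_sub (simple_root Sx) (simple_root Sy) d0.
have nxy : (x == y) = false by apply/eqP.
have nyx : (y == x) = false by rewrite eq_sym.
move=> /root_comb[/comb_cf h|/comb_cf h].
  have /natr_ge0 := h _ Sy; rewrite linearB !cfE //= nyx eqxx sub0r oppr_ge0.
  by rewrite ler10.
have /natr_ge0 := h _ Sx; rewrite linearN linearB !cfE //= nxy eqxx subr0.
by rewrite oppr_ge0 ler10.
Qed.

Lemma span_dotv v w : span S v -> dotv v w = \sum_(x <- sS) cf x v * dotv x w.
Proof.
move=> Sv; rewrite -[in LHS](subrK (\sum_(x <- sS) cf x v *: x) v).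
rewrite (_ : v - _ = 0) ?add0r; last first.
  apply: cf_inj => [|y Sy].
    apply: spanB => //; exists sS, (fun x => cf x v); split=> // x; by move=> /sSE.
  rewrite linearB linear_sum (bigD1_seq y) //=; last exact/sSE.
  rewrite linearZ /= [cf y y]cfE // eqxx mulr1 big_seq_cond big1 ?addr0 ?subrr // => x.
  move=> /andP[/sSE Sx /negbTE xy]; rewrite linearZ /= [cf y x]cfE //
    eq_sym xy; exact: mulr0.
by rewrite dotv_suml; apply: eq_bigr => x _; rewrite dotvZl.
Qed.

(** As [dotv (a - b) (a - b)] is positive, some term of its expansion over [S] is positive. The sign
    of [dotv a k] or of [dotv b k] then allows a move of one end towards the other; the four cases
    are [a - k], [a + k], [b - k] and [b + k]. *)
Lemma simple_step_toward a b : pos a -> pos b -> a <> b ->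
  exists k, S k /\
    [\/ cf k b < cf k a /\ 0 < dotv a k, cf k a < cf k b /\ dotv a k < 0,
        cf k a < cf k b /\ 0 < dotv b k | cf k b < cf k a /\ dotv b k < 0].
Proof.
move=> [Ra _] [Rb _] ab; apply: contrapT => H; apply: ab; apply/subr0_eq.
apply: dotvv_eq0; apply/eqP; rewrite eq_le dotvv_ge0 andbT.
rewrite span_dotv; last by apply: spanB; apply: root_span.
rewrite big_seq; apply: sumr_le0 => k /sSE Sk.
rewrite linearB dotvBr !(dotvC k).
have [lab|lba|->] := ltgtP (cf k a) (cf k b); last by rewrite subrr mul0r.
  rewrite nmulr_rle0 ?subr_lt0 // subr_ge0.
  apply: (@le_trans _ _ 0); rewrite leNgt; apply/negP => ?; apply: H; exists k.
    by split=> //; apply: Or43.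
  by split=> //; apply: Or42.
rewrite pmulr_rle0 ?subr_gt0 // subr_le0.
apply: (@le_trans _ _ 0); rewrite leNgt; apply/negP => ?; apply: H; exists k.
  by split=> //; apply: Or41.
by split=> //; apply: Or44.
Qed.

(** Applied to the difference of the two ends of a path, it measures how many simple steps
    remain. *)
Let l1 v := \sum_(x <- sS) `|cf x v|.

Lemma l1_ge0 v : 0 <= l1 v. Proof. exact: sumr_ge0. Qed.

Lemma l1N v : l1 (- v) = l1 v.
Proof. by apply: eq_bigr => x _; rewrite linearN normrN. Qed.

Lemma l1_step v k : S k -> 1 <= cf k v -> l1 (v - k) = l1 v - 1.
Proof.
move=> Sk v1; have ks : k \in sS by apply/sSE.
rewrite /l1 !(bigD1_seq k) //= linearB [cf k k]cfE // eqxx /=.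
rewrite ger0_norm ?subr_ge0 // ger0_norm ?(le_trans ler01) //.
rewrite [RHS]addrAC; congr (_ + _); rewrite
big_seq_cond [RHS]big_seq_cond; apply: eq_bigr => x /andP[/sSE Sx /negbTE xk].
by rewrite linearB [cf x k]cfE // xk subr0.
Qed.

(** Integrality of root coordinates turns a strict inequality into a gap of one, so a simple step
    never overshoots. *)
Lemma int_gap a b k : Rt a -> Rt b -> S k -> cf k b < cf k a -> 1 <= cf k (a - b).
Proof.
move=> Ra Rb Sk ltba; rewrite linearB.
have := subr_gt0 (cf k b) (cf k a); rewrite ltba.
have : cf k a - cf k b \is a Num.int by rewrite rpredB ?root_int.
by case/intrP => z ->; rewrite ltr0z ler1z gtz0_ge1.
Qed.

Section Paths.
(* Positivity of the coordinates in [M] along a path keeps it away from [0]. *)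
Variables (T M E : set 'rV[R]_n) (x0 : 'rV[R]_n).
Hypotheses (MS : M `<=` S) (Mx0 : M x0).
Hypothesis stepT : forall c k, S k -> E k -> pos c ->
  (forall x, M x -> 0 < cf x c) -> pos (c + k) -> (T c <-> T (c + k)).

Let good c := pos c /\ forall x, M x -> 0 < cf x c.

(** [a + k] is a root or [0], and [0] is excluded because the coordinate at [x0] stays positive. *)
Lemma good_step_up a b k : good a -> good b -> S k -> E k ->
  cf k a < cf k b -> dotv a k < 0 ->
  [/\ good (a + k), T a <-> T (a + k) & l1 (b - (a + k)) = l1 (b - a) - 1].
Proof.
move=> [pa Ma] [pb Mb] Sk Ek ltab ak.
have cfk x : S x -> cf x a <= cf x (a + k).
  by move=> Sx; rewrite linearD lerDl cfE // ler0n.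
have pak : pos (a + k).
  apply/posP; split=> [|x Sx]; last by rewrite (le_trans (pos_cf pa Sx)) ?cfk.
  have [ak0|//] := root_add (proj1 pa) (simple_root Sk) ak.
  by have := lt_le_trans (Ma _ Mx0) (cfk _ (MS Mx0)); rewrite ak0 linear0 ltxx.
split; [split=> // x Mx | exact: stepT | ].
  exact: lt_le_trans (Ma _ Mx) (cfk _ (MS Mx)).
rewrite opprD addrA (@l1_step (b - a) k) //.
by apply: int_gap => //; [case: pb|case: pa].
Qed.

(** The only coordinate that drops, the one at [k], stays at least [cf k b]; positivity is therefore
    inherited from [b] there and from [a] elsewhere. *)
Lemma good_step_down a b k : good a -> good b -> S k -> E k ->
  cf k b < cf k a -> 0 < dotv a k ->
  [/\ good (a - k), T a <-> T (a - k) & l1 ((a - k) - b) = l1 (a - b) - 1].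
Proof.
move=> [pa Ma] [pb Mb] Sk Ek ltba ak.
have gap : 1 <= cf k (a - b) by apply: int_gap => //; [case: pa|case: pb].
have cfk x : S x -> x <> k -> cf x (a - k) = cf x a.
  by move=> Sx /eqP/negbTE xk; rewrite linearB [cf x k]cfE // xk subr0.
have cfkk : cf k b <= cf k (a - k).
  by rewrite linearB [cf k k]cfE // eqxx -subr_ge0 addrAC -linearB subr_ge0.
have Mak x : M x -> 0 < cf x (a - k).
  have [-> Mk|xk Mx] := pselect (x = k); first by apply: lt_le_trans cfkk; apply: Mb.
  by rewrite cfk //; [exact: Ma|exact: MS].
have pak : pos (a - k).
  apply/posP; split=> [|x Sx].
    have [ak0|//] := root_sub (proj1 pa) (simple_root Sk) ak.
    by have := Mak _ Mx0; rewrite ak0 linear0 ltxx.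
  have [->|/cfk ->//] := pselect (x = k); last exact: pos_cf.
  by apply: le_trans cfkk; apply: pos_cf.
split; [by split | | ].
  by apply: iff_sym; rewrite -{2}(subrK k a); apply: stepT; rewrite ?subrK.
by rewrite addrAC (@l1_step (a - b) k).
Qed.

(** The last clause records that a step creates no new differing coordinate, which keeps all later
    steps inside [E]. *)
Lemma good_progress a b : good a -> good b -> a <> b ->
  (forall k, S k -> cf k a <> cf k b -> E k) ->
  exists a' b', [/\ good a' /\ good b', T a <-> T a', T b <-> T b',
    l1 (a' - b') = l1 (a - b) - 1 &
    forall x, S x -> cf x a' <> cf x b' -> cf x a <> cf x b].
Proof.
move=> ga gb ab abE.
have l1C v w : l1 (v - w) = l1 (w - v) by rewrite -opprB l1N.
have cfk k x v : S k -> S x -> x <> k ->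
    cf x (v + k) = cf x v /\ cf x (v - k) = cf x v.
  move=> Sk Sx /eqP/negbTE xk.
  by rewrite linearB linearD [cf x k]cfE // xk subr0 addr0.
have [k [Sk step]] := simple_step_toward (proj1 ga) (proj1 gb) ab.
have nk : cf k a <> cf k b by case: step => -[h _] e; move: h; rewrite e ltxx.
have Ek := abE k Sk nk.
case: step => -[lt_ab dk].
- have [g t l] := good_step_down ga gb Sk Ek lt_ab dk.
  exists (a - k), b; split=> // x Sx.
  by have [->//|/(cfk k x a Sk Sx)[_ ->]] := pselect (x = k).
- have [g t l] := good_step_up ga gb Sk Ek lt_ab dk.
  exists (a + k), b; split=> //; first by rewrite l1C l l1C.
  by move=> x Sx; have [->//|/(cfk k x a Sk Sx)[-> _]] := pselect (x = k).
- have [g t l] := good_step_down gb ga Sk Ek lt_ab dk.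
  exists a, (b - k); split=> //; first by rewrite l1C l l1C.
  by move=> x Sx; have [->//|/(cfk k x b Sk Sx)[_ ->]] := pselect (x = k).
- have [g t l] := good_step_up gb ga Sk Ek lt_ab dk.
  exists a, (b + k); split=> // x Sx.
  by have [->//|/(cfk k x b Sk Sx)[-> _]] := pselect (x = k).
Qed.

(** Induction on a natural number bounding the real-valued distance, which drops by one at each
    step. *)
Lemma path_invariant a b : good a -> good b ->
  (forall k, S k -> cf k a <> cf k b -> E k) -> (T a <-> T b).
Proof.
have [N leN] : exists N : nat, l1 (a - b) < N%:R.
  by exists (Num.truncn (l1 (a - b))).+1; apply: truncnS_gt.
elim: N a b leN => [|N IH] a b leN ga gb abE.
  by have := le_lt_trans (l1_ge0 _) leN; rewrite ltxx.
have [->//|nab] := pselect (a = b).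
have [a' [b' [[ga' gb'] -> -> l sub]]] := good_progress ga gb nab abE.
apply: IH => //; last by move=> k Sk /(sub _ Sk); apply: abE.
by rewrite l ltrBlDr natr1.
Qed.

End Paths.

Definition has_supp a x := S x /\ 0 < cf x a.

(** The condition on [x] says that [c] lies outside [span K]. Quantifying over single simple steps
    is what makes the property pass to unions of subsets. *)
Definition step_closed T K := forall c k, K k -> pos c ->
  (exists x, has_supp c x /\ ~ K x) -> pos (c + k) -> (T c <-> T (c + k)).

Lemma pos_offP K a : K `<=` S -> pos a ->
  (~ span K a <-> exists x, has_supp a x /\ ~ K x).
Proof.
move=> KS pa; rewrite (span_cfP cfE uS sSE KS (root_span (proj1 pa))).
split=> [na|[x [[Sx ax] nKx]] /(_ x Sx nKx) a0]; last by rewrite a0 ltxx in ax.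
apply: contrapT => H; apply: na => x Sx nKx; apply/eqP.
rewrite eq_le pos_cf // andbT leNgt; apply/negP => ax.
by apply: H; exists x.
Qed.

(** Some [x] outside [K] is in the support of [a], and [b] has the same coordinate there. The path
    from [a] to [b] uses only steps in [K], and keeping the coordinate at [x] positive keeps it
    outside [span K]. *)
Lemma step_closed_fibre T K a b : K `<=` S -> step_closed T K -> pos a -> pos b ->
  span K (a - b) -> ~ span K a -> (T a <-> T b).
Proof.
move=> KS stT pa pb Kab /(pos_offP KS pa)[x [[Sx ax] nKx]].
have cfab y : S y -> ~ K y -> cf y a = cf y b.
  by move=> Sy nKy; apply/subr0_eq; rewrite -linearB (cf_span cfE KS Sy nKy Kab).
apply: (@path_invariant T [set x] K x) => //.
- by move=> y ->.
- by move=> c k Sk Kk pc /(_ x erefl) cx; apply: stT => //; exists x.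
- by split=> // y ->.
- by split=> // y ->; rewrite -cfab.
- by move=> k Sk kab; apply: contrapT => nKk; apply/kab/cfab.
Qed.

Lemma fibre_step_closed T K : K `<=` S ->
  (forall a b, pos a -> pos b -> span K (a - b) -> ~ span K a -> T a -> T b) ->
  step_closed T K.
Proof.
move=> KS H c k Kk pc offc pck.
have Kck : span K (c - (c + k)) by rewrite opprD addrA subrr sub0r; apply/spanN/mem_span.
have nKc : ~ span K c by apply/(pos_offP KS pc).
split; first exact: H.
apply: H => //; first by rewrite -opprB; apply: spanN.
by move=> Kck'; apply: nKc; rewrite -(subrK (c + k) c); apply: spanD.
Qed.

Lemma connected_edge U a b : QRS_connected S -> S a -> S b -> U a -> ~ U b ->
  exists x y, [/\ S x, S y, U x, ~ U y & dotv x y < 0].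
Proof.
move=> conn Sa Sb Ua nUb; have [p [pS [pp lp]]] := conn a b Sa Sb.
elim: p a Sa Ua pS pp lp => [|c p IH] a Sa Ua pS /=;
    first by move=> _ ab; rewrite -ab in nUb.
move=> /andP[ac pp] lp; have Sc : S c by apply: pS; rewrite mem_head.
have [Uc|nUc] := pselect (U c); last by exists a, c.
by apply: (IH c) => // x xp; apply: pS; rewrite in_cons xp orbT.
Qed.

(** In the expansion of [dotv a y] the term at [x] is negative, the one at [y] is zero, and the
    others are nonpositive by [simple_obtuse]. So [a + y] is a root or [0], and its coordinate at
    [y] rules out [0]. *)
Lemma add_neighbour a x y : pos a -> has_supp a x -> S y -> ~ has_supp a y ->
  dotv x y < 0 ->
  pos (a + y) /\ (forall z, has_supp (a + y) z <-> has_supp a z \/ z = y).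
Proof.
move=> pa [Sx ax] Sy nay xy.
have cfD z : S z -> cf z (a + y) = cf z a + (z == y)%:R
    by move=> Sz; rewrite linearD [cf z y]cfE.
have ay : dotv a y < 0.
  rewrite span_dotv; last exact: root_span (proj1 pa).
  have xs : x \in sS by apply/sSE.
  rewrite (bigD1_seq x) //= -[ltRHS]addr0; apply: ltr_leD.
    by rewrite pmulr_rlt0.
  rewrite big_seq_cond; apply: sumr_le0 => z /andP[/sSE Sz _].
  have [zy|zy] := pselect (z = y); last first.
    by apply: mulr_ge0_le0; [exact: pos_cf|exact: simple_obtuse].
  have a0 := pos_cf pa Sz.
  suff -> : cf z a = 0 by rewrite mul0r.
  apply/eqP; rewrite eq_le a0 andbT leNgt; apply/negP => az.
  by apply: nay; rewrite -zy.
have supp z : has_supp (a + y) z <-> has_supp a z \/ z = y.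
  split=> [[Sz]|[[Sz az]|->]].
  - rewrite cfD //; case: eqP => [->|_]; first by right.
    by rewrite addr0; left.
  - by split=> //; rewrite cfD // ltr_wpDr // ler0n.
  - by split=> //; rewrite cfD // eqxx ltr_wpDl // pos_cf.
split=> //; apply/posP; split; last first.
  by move=> z Sz; rewrite cfD // addr_ge0 ?ler0n // pos_cf.
have [ay0|//] := root_add (proj1 pa) (simple_root Sy) ay.
have [_] := proj2 (supp y) (or_intror erefl).
by rewrite ay0 linear0 ltxx.
Qed.

Lemma pos_simple x : S x -> pos x.
Proof.
move=> Sx; apply/posP; split; first exact: simple_root.
by move=> y Sy; rewrite cfE // ler0n.
Qed.

Lemma supp_exists a : pos a -> exists x, has_supp a x.
Proof.
move=> pa; have /(pos_offP (@sub0set _ S) pa)[x [ax _]] : ~ span set0 a.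
  by move=> /span_set0 a0; apply: root_neq0; rewrite -a0; case: pa.
by exists x.
Qed.

(** * Roots of full support in the connected case *)

Section Connected.
Hypothesis connS : QRS_connected S.

(** While the support is not all of [S], connectedness gives an edge leaving it, whose outer end can
    be added; the number of missing simple roots decreases. *)
Lemma grow_to_full T a : pos a ->
  (forall c y, pos c -> has_supp a `<=` has_supp c -> S y -> pos (c + y) ->
     (T c <-> T (c + y))) ->
  exists b, [/\ pos b, S `<=` has_supp b & T a <-> T b].
Proof.
pose missing a := [seq x <- sS | ~~ `[< has_supp a x >]].
have [N leN] : exists N, (size (missing a) < N)%N by exists (size (missing a)).+1.
elim: N a leN => // N IH a leN pa stT.
have [full|/existsNP[b /not_implyP[Sb nab]]] := pselect (S `<=` has_supp a).
  by exists a.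
have [x ax] := supp_exists pa.
have [x' [y [_ Sy ax' nay xy]]] := connected_edge connS (proj1 ax) Sb ax nab.
have [pay supp] := add_neighbour pa ax' Sy nay xy.
have sub : has_supp a `<=` has_supp (a + y) by move=> z az; apply/supp; left.
have [||c [pc fc Tc]] := IH (a + y) _ pay.
- rewrite -ltnS; apply: leq_trans leN; rewrite ltnS.
  apply: (@uniq_leq_size _ (y :: missing (a + y))).
    rewrite /= filter_uniq // andbT mem_filter negb_and negbK.
    by apply/orP; left; apply/asboolP/supp; right.
  move=> z; rewrite in_cons !mem_filter => /orP[/eqP ->|/andP[/asboolPn naz ->]].
    by apply/andP; split; [exact/asboolPn|exact/sSE].
  by rewrite andbT; apply/asboolPn => /sub.
- by move=> c z pc ac; apply: stT => // w /sub /ac.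
exists c; split=> //; apply: iff_trans Tc; exact: stT.
Qed.

Lemma full_root x : S x -> exists f, pos f /\ S `<=` has_supp f.
Proof.
(* With [set0] in place of [T] the invariance condition is trivial. *)
by move=> /pos_simple /(@grow_to_full set0)[//|f [pf ff _]]; exists f.
Qed.

(** For saturated [T] this says that the quotient part is full or empty. It holds vacuously when [K]
    is [S]. *)
Definition trivial_off T K :=
  (forall c, pos c -> ~ span K c -> T c) \/ (forall c, pos c -> ~ span K c -> ~ T c).

(** A root of full support lies outside both spans and would be both in [T] and not in [T]. *)
Lemma trivial_off_same_kind T K1 K2 : K1 `<=` S -> K2 `<=` S -> K1 <> S -> K2 <> S ->
  (forall c, pos c -> ~ span K1 c -> T c) ->
  (forall c, pos c -> ~ span K2 c -> ~ T c) -> False.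
Proof.
move=> K1S K2S nK1 nK2 h1 h2.
have outside K : K `<=` S -> K <> S -> exists x, S x /\ ~ K x.
  move=> KS nK; apply: contrapT => H; apply: nK; apply/seteqP; split=> // x Sx.
  by apply: contrapT => nKx; apply: H; exists x.
have [x [Sx nx]] := outside _ K1S nK1; have [y [Sy ny]] := outside _ K2S nK2.
have [f [pf ff]] := full_root Sx.
apply: (h2 f pf); first by apply/(pos_offP K2S pf); exists y; split=> //; exact: ff.
by apply: h1 => //; apply/(pos_offP K1S pf); exists x; split=> //; exact: ff.
Qed.

(* All roots [c] outside both [span K1] and [span K2] have the same status as a
   root [f] of full support. If no [a] outside [K1] works, the simple roots
   occurring in some root outside [span K1] of the other status form a set [U]
   that contains the complement of [K1], avoids the complement of [K2], and has
   no edge leaving it. *)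
Lemma step_closed_cover T K1 K2 a0 b0 : K1 `<=` S -> K2 `<=` S ->
  step_closed T K1 -> step_closed T K2 -> (forall x, S x -> K1 x \/ K2 x) ->
  S a0 -> ~ K1 a0 -> S b0 -> ~ K2 b0 ->
  exists a, [/\ S a, ~ K1 a & trivial_off T (S `\ a)].
Proof.
move=> K1S K2S st1 st2 cover Sa0 na0 Sb0 nb0.
pose off K c := exists x, has_supp c x /\ ~ K x.
have st c y : pos c -> off K1 c -> off K2 c -> S y -> pos (c + y) ->
    (T c <-> T (c + y)).
  by move=> pc o1 o2 /cover[]; [move=> /st1|move=> /st2]; apply.
have [f [pf ff]] := full_root Sa0.
have offS K c x : S `<=` has_supp c -> S x -> ~ K x -> off K c.
  by move=> fc /fc cx nKx; exists x.
(* Two roots of full support are joined through roots of full support: all of [S] serves both as the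
   coordinates kept positive and as the allowed directions. *)
have fullT c : pos c -> S `<=` has_supp c -> (T c <-> T f).
  move=> pc fc; apply: (@path_invariant T S S a0) => //.
  - by move=> d k Sk _ pd fd; apply: st => //; [exists a0|exists b0]; split=> //;
      split=> //; apply: fd.
  - by split=> // x /fc[].
  - by split=> // x /ff[].
(* Growing [c] to full support only enlarges its support, so every step stays off both subsets,
   where [st] applies. *)
have bothT c : pos c -> off K1 c -> off K2 c -> (T c <-> T f).
  move=> pc [x [cx nx]] [y [cy ny]].
  have [|d [pd fd ->]] := @grow_to_full T c pc; last exact: fullT.
  move=> d z pd cd; apply: st => //; [exists x|exists y]; split=> //; exact: cd.
apply: contrapT => H.
pose U s := exists c, [/\ pos c, has_supp c s, off K1 c & ~ (T c <-> T f)].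
(* If [a] were not in [U], all roots with [a] in their support would have the status of [f]. These
   are the roots outside the span of [S] without [a], so [a] would be the element that [H]
   denies. *)
have UA a : S a -> ~ K1 a -> U a.
  move=> Sa na; apply: contrapT => nU; apply: H; exists a; split=> //.
  have same c : pos c -> ~ span (S `\ a) c -> (T c <-> T f).
    move=> pc /(pos_offP (@subDsetl _ S [set a]) pc)[x [cx nx]].
    have xa : x = a by apply: contrapT => xa; apply: nx; split=> //; case: cx.
    rewrite xa in cx; apply: contrapT => nT; apply: nU.
    by exists c; split=> //; exists a.
  have [Tf|nTf] := pselect (T f); [left|right] => c pc oc.
    by apply/(same c).
  by move=> /(same c pc oc).
have nUb : ~ U b0.
  by move=> [c [pc cb o1]]; apply; apply: bothT => //; exists b0.
have [s [t [_ St [c [pc cs o1 nT]] nUt st_lt0]]] :=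
  connected_edge connS Sa0 Sb0 (UA _ Sa0 na0) nUb.
(* A [t] outside [K1] is in [U] already. A [t] in [K1] not yet in the support of [c] can be added to
   [c] by a step that preserves status, and [c + t] then puts [t] in [U]. *)
apply: nUt; have [K1t|] := pselect (K1 t); last exact: UA.
have [ct|nct] := pselect (has_supp c t); first by exists c.
have [pct supp] := add_neighbour pc cs St nct st_lt0.
exists (c + t); split=> //; first by apply/supp; right.
  by case: o1 => x [cx nx]; exists x; split=> //; apply/supp; left.
by rewrite -(st1 c t K1t pc o1 pct).
Qed.

End Connected.
End SimpleRoots.

(** * Inflations and quotients *)

Section Inflation.
Variables (R : realType) (n : nat).
Implicit Types (u v w x y a b c k : 'rV[R]_n) (Rt S Phi Psi X I K : set 'rV[R]_n).

(** One implication suffices, because [a] and [b] can be interchanged. *)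
Definition saturated Rt S Phi K := forall a b, pos_roots Rt S a -> pos_roots Rt S b ->
  proj K a = proj K b -> proj K a <> 0 -> Phi a -> Phi b.

Definition quot_part Phi K := [set v | v <> 0 /\ exists a, Phi a /\ proj K a = v].

Lemma quot_part_sub Rt S Phi K :
  Phi `<=` pos_roots Rt S -> quot_part Phi K `<=` quot_pos_roots Rt S K.
Proof. by move=> PhiR v [v0 [a [/PhiR pa av]]]; split=> //; exists a. Qed.

Lemma sub_part_sub Rt S Phi K :
  Phi `<=` pos_roots Rt S -> Phi `&` span K `<=` sub_pos_roots Rt S K.
Proof. by move=> PhiR v [/PhiR pa Kv]; split. Qed.

Lemma inflation_saturated Rt S K Psi X : fin_set K -> X `<=` sub_pos_roots Rt S K ->
  saturated Rt S (inflation Rt S K Psi X) K.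
Proof.
move=> finK XK a b pa pb ab a0 [[_ Pa]|/XK[_ /(proj_eq0 finK)//]].
by left; split=> //; rewrite -ab.
Qed.

Lemma saturated_inflation Rt S Phi K : fin_set K -> Phi `<=` pos_roots Rt S ->
  saturated Rt S Phi K -> Phi = inflation Rt S K (quot_part Phi K) (Phi `&` span K).
Proof.
move=> finK PhiR sat; apply/seteqP; split=> a.
  move=> Pa; have [Ka|nKa] := pselect (span K a); first by right.
  left; split; first exact: PhiR.
  by split; [move/(proj_eq0 finK)|exists a].
move=> [[pa [a0 [b [Pb ba]]]]|[]//].
by apply: (sat b a) => //; [exact: PhiR|rewrite ba].
Qed.

(** Outside [span K] an inflation is governed by [Psi] alone, inside it by [X] alone, and every
    element of [Psi] is the image of a positive root. Hence the subset [K] determines both parts. *)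
Lemma inflation_parts Rt S Phi K Psi X : fin_set K ->
  Psi `<=` quot_pos_roots Rt S K -> X `<=` sub_pos_roots Rt S K ->
  Phi = inflation Rt S K Psi X -> Psi = quot_part Phi K /\ X = Phi `&` span K.
Proof.
move=> finK PsiK XK ->; split; apply/seteqP; split=> v.
- move=> Pv; have [v0 [a [pa av]]] := PsiK _ Pv; split=> //.
  exists a; split=> //; left; split=> //; last by rewrite av.
- move=> [v0 [a [[[_ Pa]|/XK[_ /(proj_eq0 finK) a0]] av]]]; first by rewrite -av.
  by case: v0; rewrite -av.
- by move=> Xv; split; [right|case: (XK _ Xv)].
- by move=> [[[_ /PsiK[v0 _]]|//] Kv]; case: v0; apply/(proj_eq0 finK).
Qed.

(** The iterated projection differs from [v] by a vector of [span K]. It is orthogonal to [I] and to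
    the images of the rest of [K], hence to [K]. *)
Lemma proj_comp I K v : fin_set K -> I `<=` K ->
  proj (proj I @` (K `\` I)) (proj I v) = proj K v.
Proof.
move=> finK IK; have finI := fin_set_sub IK finK.
have finK' : fin_set (proj I @` (K `\` I)).
  by apply: fin_set_image; apply: fin_set_sub finK; apply: subDsetl.
set K' := proj I @` _; have [ow sw] := projP finK' (proj I v).
have [oI sI] := projP finI v.
have K'K : span K' `<=` span K.
  apply: span_sub => _ [k [Kk _] <-].
  rewrite -[proj I k](subKr k); apply: spanB; first exact: mem_span.
  by apply: (spanS IK); apply: span_subproj.
have oIw : orth I (proj K' (proj I v)).
  move=> i Ii; rewrite -[X in dotv _ X](subKr (proj I v)) dotvBr oI // sub0r.
  suff -> : dotv i (proj I v - proj K' (proj I v)) = 0 by rewrite oppr0.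
  rewrite dotvC; apply: orth_span sw => _ [k _ <-].
  by rewrite dotvC; case: (projP finI k) => + _; apply.
symmetry; apply: proj_uniq => // [k Kk|]; last first.
  rewrite -(subrK (proj I v) v) -addrA; apply: spanD; first exact: (spanS IK).
  by apply: K'K; rewrite subrK.
have [Ik|nIk] := pselect (I k); first exact: oIw.
rewrite -(subrK (proj I k) k) dotvDl (orth_span oIw (span_subproj finI k)) add0r.
by apply: ow; exists k.
Qed.

End Inflation.

(** * Saturated subsets of the base and the two alternatives *)

Section Quotient.
Variables (R : realType) (n : nat) (Rt S : set 'rV[R]_n).
Variables (sS : seq 'rV[R]_n) (cf : 'rV[R]_n -> {scalar 'rV[R]_n}).
Hypotheses (uS : uniq sS) (sSE : forall x, S x <-> x \in sS).
Hypothesis cfE : forall x y, S x -> S y -> cf x y = (x == y)%:R.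
Hypothesis simple_root : S `<=` Rt.
Hypothesis root_comb :
  forall a, Rt a -> nonneg_int_comb S a \/ nonneg_int_comb S (- a).
Hypothesis root_neq0 : ~ Rt 0.
Hypothesis rootN : forall a, Rt a -> Rt (- a).
Hypothesis root_add :
  forall a b, Rt a -> Rt b -> dotv a b < 0 -> a + b = 0 \/ Rt (a + b).
Hypothesis connS : QRS_connected S.
Implicit Types (u v w x y a b c k : 'rV[R]_n) (Phi Psi X I K : set 'rV[R]_n).

Local Notation pos := (pos_roots Rt S).

Lemma fin_base K : K `<=` S -> fin_set K.
Proof. by move=> KS; apply: fin_set_sub KS _; exists sS. Qed.

Lemma saturated_step_closed Phi K : K `<=` S ->
  saturated Rt S Phi K <-> step_closed Rt S cf Phi K.
Proof.
move=> KS; have finK := fin_base KS; split=> [sat|st a b pa pb ab a0].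
  apply: (fibre_step_closed uS sSE cfE root_comb) => // a b pa pb ab na.
  by apply: sat => //; [apply/(proj_eq finK)|move/(proj_eq0 finK)].
apply: (proj1 (step_closed_fibre uS sSE cfE simple_root root_comb root_neq0
  rootN root_add KS st pa pb _ _)); first exact/(proj_eq finK).
by move/(proj_eq0 finK).
Qed.

(** Projection along [I] keeps the coordinates outside [I]. For a negative root whose image is a
    nonnegative combination these coordinates are all zero, so the image is [0]. *)
Lemma quot_pos_rootsE I : I `<=` S ->
  pos_roots (quot_roots Rt I) (quot_base S I) = quot_pos_roots Rt S I.
Proof.
move=> IS; have finI := fin_base IS.
have cfI x v : S x -> ~ I x -> cf x (proj I v) = cf x v.
  move=> Sx nIx; apply/eqP; rewrite eq_sym -subr_eq0 -linearB.
  by rewrite (cf_span cfE IS Sx nIx (span_subproj finI v)).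
apply/seteqP; split=> v.
  move=> [[v0 [a [Ra av]]] vS]; split=> //; exists a; split=> //; split=> //.
  case: (root_comb Ra) => // Na; case: v0; rewrite -av; apply/(proj_eq0 finI).
  apply/(span_cfP cfE uS sSE IS (root_span root_comb Ra)) => x Sx nIx.
  apply/eqP; rewrite eq_le; apply/andP; split.
    by rewrite -oppr_ge0 -linearN; apply: natr_ge0; apply: (comb_cf cfE).
  rewrite -cfI // av; move: v vS {av}; apply: nonneg_int_comb_ind; first by rewrite linear0.
  move=> m _ w [y [Sy _] <-] w0; rewrite linearP cfI // cfE //.
  by rewrite addr_ge0 // mulr_ge0.
move=> [v0 [a [[Ra aS] av]]]; split; first by split=> //; exists a.
rewrite -av; move: a aS {Ra av}; apply: nonneg_int_comb_ind.
  suff -> : proj I 0 = 0 by exact: nonneg_int_comb0.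
  by apply/(proj_eq0 finI); exact: span0.
move=> m x w Sx wS; rewrite projD // projZ //; apply: nonneg_int_combD => //.
have [Ix|nIx] := pselect (I x); last by apply: nonneg_int_combZ; exists x.
have -> : proj I x = 0 by apply/(proj_eq0 finI)/mem_span.
by rewrite scaler0; exact: nonneg_int_comb0.
Qed.

(** By [proj_comp], the fibres of the second projection pull back to fibres of [proj K]. Saturation
    at [I] passes from an element of [Phi] with a given image to any other positive root with that
    image. *)
Lemma quot_part_saturated Phi I K : I `<=` K -> K `<=` S -> Phi `<=` pos ->
  saturated Rt S Phi I ->
  saturated (quot_roots Rt I) (quot_base S I) (quot_part Phi I) (proj I @` (K `\` I))
  <-> saturated Rt S Phi K.
Proof.
move=> IK KS PhiR satI; have IS := subset_trans IK KS.
have finK := fin_base KS; have finI := fin_base IS.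
have nI c : proj K c <> 0 -> proj I c <> 0.
  by move=> Kc /(proj_eq0 finI) /(spanS IK) /(proj_eq0 finK).
rewrite /saturated quot_pos_rootsE //; split=> [sat a b pa pb ab a0 Pa|sat].
  have [|||||_ [c [Pc cb]]] := sat (proj I a) (proj I b); rewrite ?proj_comp //.
  - by split; [exact: nI|exists a].
  - by split; [apply: nI; rewrite -ab|exists b].
  - by split; [exact: nI|exists a].
  apply: (satI c b) => //; first exact: PhiR.
  by rewrite cb; apply: nI; rewrite -ab.
move=> _ _ [_ [a [pa <-]]] [_ [b [pb <-]]]; rewrite !proj_comp // => ab Ka.
move=> [_ [c [Pc ca]]]; split; first by apply: nI; rewrite -ab.
exists b; split=> //; apply: (sat a b) => //; apply: (satI c a) => //.
  exact: PhiR.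
by rewrite ca; apply: nI.
Qed.

Lemma trivial_off_saturated Phi K : K `<=` S -> trivial_off Rt S Phi K ->
  saturated Rt S Phi K.
Proof.
move=> KS; have finK := fin_base KS; case=> h a b pa pb ab a0.
  by move=> _; apply: h => // /(proj_eq0 finK); rewrite -ab.
by move=> Pa; case: (h a pa) => // /(proj_eq0 finK).
Qed.

Lemma trivial_off_quot_part Phi K : K `<=` S -> Phi `<=` pos -> saturated Rt S Phi K ->
  trivial_off Rt S Phi K <->
  quot_part Phi K = set0 \/ quot_part Phi K = quot_pos_roots Rt S K.
Proof.
move=> KS PhiR sat; have finK := fin_base KS; split.
  move=> [h|h]; [right|left]; apply/seteqP; split=> //.
  - exact: quot_part_sub.
  - move=> v [v0 [a [pa av]]]; split=> //; exists a; split=> //.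
    by apply: h => // /(proj_eq0 finK); rewrite av.
  - move=> v [v0 [a [Pa av]]]; apply: (h a) => //; first exact: PhiR.
    by move/(proj_eq0 finK); rewrite av.
move=> [e|e]; [right|left] => c pc Kc.
  move=> Pc; have : quot_part Phi K (proj K c).
    by split; [move/(proj_eq0 finK)|exists c].
  by rewrite e.
have [_ [a [Pa ac]]] : quot_part Phi K (proj K c).
  by rewrite e; split; [move/(proj_eq0 finK)|exists c].
apply: (sat a c) => //; first exact: PhiR.
by rewrite ac => /(proj_eq0 finK).
Qed.

(** Alternative (i), pulled back from the quotient to the subsets of [S] containing [I]. *)
Definition maximal_nontrivial Phi I := ~ trivial_off Rt S Phi I /\
  forall K, I `<=` K -> K `<=` S -> saturated Rt S Phi K -> K = I \/ K = S.

(** Alternative (ii), freed from [Psi] and [X], which the subset determines. *)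
Definition least_trivial Phi I := trivial_off Rt S Phi I /\
  forall K, K `<=` S -> trivial_off Rt S Phi K -> I `<=` K.

(** Subsets of the quotient base correspond to the subsets of [S] containing [I], the empty one to
    [I] and the whole base to [S]. Being an inflation in the quotient corresponds to saturation in
    [S]. *)
Lemma decomp_alt_iP Phi I : I `<=` S -> Phi `<=` pos -> saturated Rt S Phi I ->
  decomp_alt_i Rt S I (quot_part Phi I) <-> maximal_nontrivial Phi I.
Proof.
move=> IS PhiR sat; have finI := fin_base IS.
have quotR := quot_part_sub (K := I) PhiR; rewrite -quot_pos_rootsE // in quotR.
rewrite /maximal_nontrivial trivial_off_quot_part //; split.
  move=> [n0 nT prim]; split=> [[//|e]|K IK KS satK].
    by apply: nT; rewrite quot_pos_rootsE.
  have finK' : fin_set (proj I @` (K `\` I)).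
    exact: fin_set_image (fin_set_sub (@subDsetl _ _ _) (fin_base KS)).
  have [] := prim (proj I @` (K `\` I)) _ _ _ _ _
    (saturated_inflation finK' quotR (proj2 (quot_part_saturated IK KS PhiR sat) satK)).
  - by move=> _ [k [Kk nIk] <-]; exists k => //; split=> //; exact: KS.
  - exact: quot_part_sub.
  - exact: sub_part_sub.
  - move=> e; left; apply/seteqP; split=> // x Kx; apply: contrapT => nIx.
    suff : (proj I @` (K `\` I)) (proj I x) by rewrite e.
    by exists x.
  - move=> e; right; apply/seteqP; split=> // x Sx.
    have [/IK//|nIx] := pselect (I x).
    have : quot_base S I (proj I x) by exists x.
    (* Distinct simple roots outside [I] have distinct images: otherwise [k - x] would lie in
       [span I], yet have coordinate [-1] at [x]. *)
    rewrite -e => -[k [Kk nIk] /(proj_eq finI) /(cf_span cfE IS Sx nIx)].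
    have Sk := KS _ Kk; rewrite linearB [cf x k]cfE // [cf x x]cfE // eqxx.
    by case: eqP => [->//|_] /eqP; rewrite sub0r oppr_eq0 oner_eq0.
move=> [ntriv maxI]; split=> [e|e|K' Psi' X' K'S _ X'K' e].
- by apply: ntriv; left.
- by apply: ntriv; right; rewrite -quot_pos_rootsE.
pose K := I `|` [set x | S x /\ K' (proj I x)].
have IK : I `<=` K by move=> x; left.
have KS : K `<=` S by move=> x [/IS//|[]].
have K'E : K' = proj I @` (K `\` I).
  apply/seteqP; split=> [v K'v|_ [x [[//|[_ K'x]] _] <-//]].
  have [x [Sx nIx] xv] := K'S _ K'v; exists x => //.
  by split=> //; right; split=> //; rewrite xv.
have finK' : fin_set K'.
  rewrite K'E; exact: fin_set_image (fin_set_sub (@subDsetl _ _ _) (fin_base KS)).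
have satK : saturated Rt S Phi K.
  apply/(quot_part_saturated IK KS PhiR sat); rewrite -K'E {1}e.
  exact: inflation_saturated.
rewrite K'E; case: (maxI K IK KS satK) => ->; [left|by right].
by rewrite setDv image_set0.
Qed.

Lemma decomp_alt_iiP Phi I : I `<=` S -> Phi `<=` pos -> saturated Rt S Phi I ->
  decomp_alt_ii Rt S Phi I (quot_part Phi I) <-> least_trivial Phi I.
Proof.
move=> IS PhiR sat; rewrite /decomp_alt_ii -trivial_off_quot_part //.
split=> -[triv minI]; split=> // K.
  move=> KS trivK; have satK := trivial_off_saturated KS trivK.
  apply: (minI K (quot_part Phi K) (Phi `&` span K)) => //.
  - exact/trivial_off_quot_part.
  - exact: sub_part_sub.
  - exact: saturated_inflation (fin_base KS) _ _.
move=> Psi X KS trivK XK e; apply: minI => //.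
have satK : saturated Rt S Phi K by rewrite e; apply: inflation_saturated (fin_base KS) _.
apply/trivial_off_quot_part => //.
have PsiK : Psi `<=` quot_pos_roots Rt S K by case: trivK => ->.
by have [<- _] := inflation_parts (fin_base KS) PsiK XK e.
Qed.

(** Mutual exclusion is automatic: one alternative contains triviality at [I], the other its
    negation. *)
Lemma good_decompP Phi I Psi X : Phi `<=` pos ->
  good_decomp Rt S Phi I Psi X <->
  [/\ I `<=` S /\ I <> S, saturated Rt S Phi I, Psi = quot_part Phi I,
      X = Phi `&` span I & maximal_nontrivial Phi I \/ least_trivial Phi I].
Proof.
move=> PhiR; split.
  move=> [[IS nI] PsiI XI e [alt _]]; have finI := fin_base IS.
  have sat : saturated Rt S Phi I by rewrite e; apply: inflation_saturated.
  have [PsiE XE] := inflation_parts finI PsiI XI e; split=> //.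
  by rewrite -decomp_alt_iP // -decomp_alt_iiP // -PsiE.
move=> [[IS nI] sat -> -> alt]; split=> //.
- exact: quot_part_sub.
- exact: sub_part_sub.
- exact: saturated_inflation (fin_base IS) _ _.
rewrite decomp_alt_iP // decomp_alt_iiP //; split=> //.
by case=> -[ntriv _] [].
Qed.

(** * Existence and uniqueness of the index subset *)

Lemma maximal_saturated Phi : S !=set0 -> exists I, [/\ I `<=` S, I <> S,
  saturated Rt S Phi I &
  forall K, I `<=` K -> K `<=` S -> saturated Rt S Phi K -> K = I \/ K = S].
Proof.
move=> [x0 Sx0].
pose elems K := [seq x <- sS | `[< K x >]].
pose P m := `[< exists K, [/\ K `<=` S, K <> S, saturated Rt S Phi K & 
  size (elems K) = m] >].
have exP : exists m, P m.
  (* The empty set is a candidate, since projection along it is the identity. *)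
  exists 0%N; apply/asboolP; exists set0; split=> //.
  - by move=> e; rewrite -e in Sx0.
  - by move=> a b _ _; rewrite !proj_set0 => ->.
  - by rewrite /elems (eq_filter (a2 := pred0)) ?filter_pred0 // => x; apply/asboolPn.
have leP m : P m -> (m <= size sS)%N.
  by move=> /asboolP[K [_ _ _ <-]]; rewrite size_filter count_size.
case: (ex_maxnP exP leP) => m /asboolP[I [IS nI satI Im]] maxm.
exists I; split=> // K IK KS satK.
have [->|nK] := pselect (K = S); [by right|left].
have leKm : (size (elems K) <= m)%N by apply: maxm; apply/asboolP; exists K.
apply/seteqP; split=> // x Kx; apply: contrapT => nIx.
move: leKm; rewrite leqNgt -Im => /negP; apply.
apply: (@uniq_leq_size _ (x :: elems I)).
  rewrite /= filter_uniq // andbT mem_filter negb_and; apply/orP; left.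
  exact/asboolPn.
move=> z; rewrite in_cons !mem_filter => /orP[/eqP ->|/andP[/asboolP /IK Kz ->]].
  by apply/andP; split; [exact/asboolP|exact/sSE/KS].
by rewrite andbT; apply/asboolP.
Qed.

Lemma saturated_sub_maximal Phi I K : I `<=` S -> I <> S -> K `<=` S -> K <> S ->
  saturated Rt S Phi I -> maximal_nontrivial Phi I -> saturated Rt S Phi K -> K `<=` I.
Proof.
move=> IS nI KS nK satI [ntriv maxI] satK.
have /saturated_step_closed stI := satI; have /saturated_step_closed stK := satK.
have IKS : I `|` K `<=` S by move=> x [/IS|/KS].
have stIK : step_closed Rt S cf Phi (I `|` K).
  move=> c k [Ik|Kk] pc [x [cx nx]]; [apply: stI => //|apply: stK => //];
    exists x; split=> //.
    by move=> Ix; apply: nx; left.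
  by move=> Kx; apply: nx; right.
have /(saturated_step_closed _ IKS) satIK := stIK.
have outside J : J `<=` S -> J <> S -> exists x, S x /\ ~ J x.
  move=> JS nJ; apply: contrapT => H; apply: nJ; apply/seteqP; split=> // x Sx.
  by apply: contrapT => nJx; apply: H; exists x.
have [e|e] := maxI _ (@subsetUl _ I K) IKS satIK.
  by rewrite -e; apply: subsetUr.
have [a0 [Sa0 na0]] := outside _ IS nI; have [b0 [Sb0 nb0]] := outside _ KS nK.
have cover x : S x -> I x \/ K x by rewrite -e.
have [a [Sa na triv]] := step_closed_cover uS sSE cfE simple_root root_comb
  root_neq0 rootN root_add connS IS KS (stI IS) (stK KS) cover Sa0 na0 Sb0 nb0.
have DS : S `\ a `<=` S := @subDsetl _ _ _.
have ID : I `<=` S `\ a.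
  by move=> x Ix; split; [exact: IS|move=> xa; apply: na; rewrite -xa].
(* The complement of [a] contains [I] and is saturated, so it is [I], against nontriviality, or [S],
   which contains [a]. *)
have [eI|eS] := maxI _ ID DS (trivial_off_saturated DS triv).
  by case: ntriv; rewrite -eI.
by move: Sa; rewrite -eS => -[_]; case.
Qed.

Lemma decomp_index_uniq Phi I J : I `<=` S -> I <> S -> J `<=` S -> J <> S ->
  saturated Rt S Phi I -> saturated Rt S Phi J ->
  maximal_nontrivial Phi I \/ least_trivial Phi I ->
  maximal_nontrivial Phi J \/ least_trivial Phi J -> I = J.
Proof.
move=> IS nI JS nJ satI satJ.
(* [M] would lie inside [L] by [saturated_sub_maximal], and triviality passes to larger subsets. *)
have mixed L M : L `<=` S -> L <> S -> M `<=` S -> M <> S -> saturated Rt S Phi L ->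
    saturated Rt S Phi M -> maximal_nontrivial Phi L -> least_trivial Phi M -> False.
  move=> LS nL MS nM satL satM maxL [triv _].
  have /spanS ML := saturated_sub_maximal LS nL MS nM satL maxL satM.
  case: (maxL) => + _; apply.
  by case: triv => h; [left|right] => c pc nLc; apply: h => // /ML.
move=> [mI|lI] [mJ|lJ].
- by apply/seteqP; split; [apply: (@saturated_sub_maximal Phi J I)
                          |apply: (@saturated_sub_maximal Phi I J)].
- by case: (mixed I J).
- by case: (mixed J I).
- by apply/seteqP; split; [apply: (proj2 lI) => //; exact: (proj1 lJ)
                          |apply: (proj2 lJ) => //; exact: (proj1 lI)].
Qed.

Lemma decomp_index_exists Phi : S !=set0 -> exists I,
  [/\ I `<=` S, I <> S, saturated Rt S Phi I &
      maximal_nontrivial Phi I \/ least_trivial Phi I].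
Proof.
move=> S0; have [[K [KS nK trivK]]|ntriv] :=
  pselect (exists K, [/\ K `<=` S, K <> S & trivial_off Rt S Phi K]); last first.
  have [I [IS nI satI maxI]] := maximal_saturated Phi S0.
  by exists I; split=> //; left; split=> // triv; apply: ntriv; exists I.
(* The intersection of all trivial subsets. [S] is one of them, but a root outside [span I] is also
   outside the span of a proper one. *)
pose I := [set x | S x /\ forall J, J `<=` S -> trivial_off Rt S Phi J -> J x].
have IS : I `<=` S by move=> x [].
have IJ J : J `<=` S -> trivial_off Rt S Phi J -> I `<=` J by move=> JS tJ x [_]; apply.
have offI c : pos c -> ~ span I c -> exists J, [/\ J `<=` S, J <> S,
    trivial_off Rt S Phi J & ~ span J c].
  move=> pc /(pos_offP uS sSE cfE root_comb IS pc)[x [cx nIx]].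
  have [J [JS [tJ nJx]]] : exists J, J `<=` S /\ (trivial_off Rt S Phi J /\ ~ J x).
    apply: contrapT => H; apply: nIx; split; first by case: cx.
    by move=> J JS tJ; apply: contrapT => nJx; apply: H; exists J.
  exists J; split=> //; first by move=> e; apply: nJx; rewrite e; case: cx.
  by apply/(pos_offP uS sSE cfE root_comb JS pc); exists x.
have kinds := trivial_off_same_kind uS sSE cfE simple_root root_comb root_neq0
  rootN root_add connS.
have trivI : trivial_off Rt S Phi I.
  (* The kind of triviality at [K] decides that of every proper [J], as [kinds] excludes the
     opposite one. *)
  case: trivK => hK; [left|right] => c pc /(offI c pc)[J [JS nJ [hJ|hJ] nJc]].
  - exact: hJ.
  - by case: (kinds Phi K J).
  - by case: (kinds Phi J K).
  - exact: hJ.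
exists I; split=> //.
- by move=> e; apply: nK; apply/seteqP; split=> //; rewrite -e; apply: IJ.
- exact: trivial_off_saturated.
- by right.
Qed.

Lemma decomp_exists_unique Phi : S !=set0 -> Phi `<=` pos ->
  exists I Psi X, good_decomp Rt S Phi I Psi X /\
    forall I' Psi' X', good_decomp Rt S Phi I' Psi' X' ->
      [/\ I' = I, Psi' = Psi & X' = X].
Proof.
move=> S0 PhiR; have [I [IS nI satI alt]] := decomp_index_exists Phi S0.
exists I, (quot_part Phi I), (Phi `&` span I); split; first exact/good_decompP.
move=> J Psi X /(good_decompP _ _ _ PhiR)[[JS nJ] satJ -> -> altJ].
by have -> : J = I by exact: (@decomp_index_uniq Phi).
Qed.

End Quotient.

(** * Quotients of root systems *)

Section RootSystem.
Variables (R : realType) (n : nat) (D Sg J : set 'rV[R]_n).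
Hypotheses (rootD : root_system D) (baseSg : base_of D Sg) (JSg : J `<=` Sg).
Implicit Types (u v w x y a b c : 'rV[R]_n).

Lemma root_dotvv a : D a -> 0 < dotv a a.
Proof.
case: rootD => _ _ D0 _ _ Da; rewrite lt_neqAle dotvv_ge0 andbT eq_sym.
by apply/eqP => /dotvv_eq0 a0; apply: D0; rewrite -a0.
Qed.

Lemma reflect_self a : D a -> reflect_in a a = - a.
Proof.
move=> /root_dotvv/lt0r_neq0 aa; rewrite /reflect_in mulfK //.
by rewrite -{1}[a]scale1r -scalerBl -scaleN1r; congr (_ *: _); ring.
Qed.

Lemma root_opp a : D a -> D (- a).
Proof. by move=> Da; case: rootD => _ _ _ [h _] _; rewrite -reflect_self //; apply: h. Qed.

Lemma reflectK a : D a -> involutive (reflect_in a).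
Proof.
move=> /root_dotvv/lt0r_neq0 aa b; rewrite /reflect_in dotvBl dotvZl.
rewrite -addrA -opprD -scalerDl -[RHS]subr0; congr (_ - _).
rewrite -[RHS](scale0r a); congr (_ *: _); field; exact: aa.
Qed.

(* With both Cartan integers at most [-2] the sum has nonpositive norm;
   otherwise one of them is [-1] and the sum is a reflection. *)
Lemma root_system_add a b : D a -> D b -> dotv a b < 0 -> a + b = 0 \/ D (a + b).
Proof.
case: (rootD) => _ _ _ [hrefl hint] _ Da Db ab.
have cartan x y : D x -> D y -> dotv x y < 0 ->
    D (x + y) \/ dotv x x <= - dotv x y.
  move=> Dx Dy xy; have xx := root_dotvv Dx; have [z zE] := hint x y Dx Dy.
  have z0 : (z < 0).
    rewrite -(@ltrz0 R) -zE ltr_pdivrMr // mul0r dotvC; lra.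
  have [z1|z1] := eqVneq z (-1).
    left; have := hrefl x y Dx Dy.
    by rewrite /reflect_in zE z1 rmorphN1 scaleN1r opprK addrC.
  have : z <= -2 by lia.
  rewrite -(@ler_int R) -zE ler_pdivrMr // dotvC rmorphN /= => h; right; lra.
have [|aa] := cartan a b Da Db ab; first by right.
have [||bb] := cartan b a Db Da; first by rewrite dotvC.
  by rewrite addrC; right.
left; apply: dotvv_eq0; apply/eqP; rewrite eq_le dotvv_ge0 andbT.
rewrite dotvDl !dotvDr; move: bb; rewrite (dotvC b a) => bb; lra.
Qed.

Lemma fin_Sg : fin_set Sg.
Proof. by case: rootD => finD _ _ _ _;
    case: baseSg => SgD _ _ _; apply: fin_set_sub finD. Qed.

Lemma fin_J : fin_set J. Proof. exact: fin_set_sub JSg fin_Sg. Qed.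

Local Notation QR := (proj J @` (D `\` span J)).
Local Notation QS := (proj J @` (Sg `\` J)).

(* The reflections in [J] permute the fibre of [proj J] over [proj J a], so the
   sum of the fibre is orthogonal to [J]. Hence [dotv (proj J a) (proj J b)] is
   the average of [dotv x b] over [x] in the fibre. *)
Lemma fibre_neg a b : D a -> dotv (proj J a) (proj J b) < 0 ->
  exists x, [/\ D x, proj J x = proj J a & dotv x b < 0].
Proof.
move=> Da neg; have finJ := fin_J.
case: (rootD) => -[sD0 sD0E] _ _ [hrefl _] _; case: (baseSg) => SgD _ _ _.
pose F := [seq x <- undup sD0 | proj J x == proj J a].
have FE x : x \in F <-> D x /\ proj J x = proj J a.
  rewrite mem_filter mem_undup; split=> [/andP[/eqP ? /sD0E]//|[/sD0E -> ->]].
  by rewrite eqxx.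
have uF : uniq F by rewrite filter_uniq // undup_uniq.
pose sigma := \sum_(x <- F) x.
have orth_sigma : orth J sigma.
  move=> j Jj; have Dj := SgD _ (JSg Jj); have jj := root_dotvv Dj.
  have Frefl x : x \in F -> reflect_in j x \in F.
    move=> /FE[Dx xa]; apply/FE; split; first exact: hrefl.
    rewrite -xa; apply/(proj_eq finJ); rewrite /reflect_in addrAC subrr sub0r.
    by apply/spanN/spanZ/mem_span.
  have perm : perm_eq F (map (reflect_in j) F).
    apply: uniq_perm => //; first by rewrite map_inj_uniq //; apply: inv_inj (reflectK Dj).
    move=> x; apply/idP/mapP => [Fx|[y Fy ->]]; last exact: Frefl.
    by exists (reflect_in j x); [exact: Frefl|rewrite reflectK].
  have : dotv sigma j = - dotv sigma j.
    rewrite {1}/sigma (perm_big _ perm) big_map !dotv_suml -sumrN.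
    apply: eq_bigr => x _; rewrite /reflect_in dotvBl dotvZl divfK ?lt0r_neq0 //.
    by ring.
  by rewrite dotvC => h; lra.
have sum_lt0 : \sum_(x <- F) dotv x b < 0.
  rewrite -dotv_suml -/sigma -(subrK (proj J b) b) dotvDr.
  rewrite [dotv sigma (_ - _)]dotvC (orth_span orth_sigma (span_subproj finJ b)) add0r.
  rewrite dotv_suml big_seq (eq_bigr (fun=> dotv (proj J a) (proj J b))); last first.
    move=> x /FE[_ xa]; rewrite -(subrK (proj J x) x) dotvDl.
    by rewrite (orth_span (orth_proj finJ b) (span_subproj finJ x)) add0r xa.
  rewrite -big_seq big_const_seq count_predT iter_addr_0.
  rewrite -mulr_natl pmulr_rlt0 ?ltr0n //.
  by rewrite -has_predT; apply/hasP; exists a => //; apply/FE.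
apply: contrapT => H; move: sum_lt0; apply/negP; rewrite -leNgt big_seq.
apply: sumr_ge0 => x /FE[Dx xa]; rewrite leNgt; apply/negP => xb.
by apply: H; exists x.
Qed.

(** [fibre_neg] trades [a'] for a root [x] of the same fibre with negative product with [b']. Then
    [x + b'] is [0] or a root, and its image is [a + b]. *)
Lemma QRS_add a b : QR a -> QR b -> dotv a b < 0 -> a + b = 0 \/ QR (a + b).
Proof.
move=> [a' [Da' _] <-] [b' [Db' _] <-] /(fibre_neg Da')[x [Dx <- xb]].
have finJ := fin_J; rewrite -projD //.
have [Jxb|nJ] := pselect (span J (x + b')); first by left; apply/(proj_eq0 finJ).
case: (root_system_add Dx Db' xb) => [xb0|Dxb]; last by right; exists (x + b').
by case: nJ; rewrite xb0; exact: span0.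
Qed.

Lemma QRS_opp a : QR a -> QR (- a).
Proof.
move=> [x [Dx nJ] <-]; exists (- x); last by rewrite projN //; exact: fin_J.
by split; [exact: root_opp|move=> /spanN; rewrite opprK].
Qed.

Lemma QRS_neq0 : ~ QR 0.
Proof. by move=> [x [_ nJ] /(proj_eq0 fin_J)]. Qed.

Lemma QRS_comb a : QR a -> nonneg_int_comb QS a \/ nonneg_int_comb QS (- a).
Proof.
have finJ := fin_J; case: baseSg => _ _ _ combSg.
have projcomb v : nonneg_int_comb Sg v -> nonneg_int_comb QS (proj J v).
  move: v; apply: nonneg_int_comb_ind => [|m x v Sgx IH].
    have -> : proj J 0 = 0 by apply/(proj_eq0 finJ); exact: span0.
    exact: nonneg_int_comb0.
  rewrite projD // projZ //; apply: nonneg_int_combD => //.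
  have [Jx|nJx] := pselect (J x); last by apply: nonneg_int_combZ; exists x.
  have -> : proj J x = 0 by apply/(proj_eq0 finJ)/mem_span.
  by rewrite scaler0; exact: nonneg_int_comb0.
move=> [x [Dx _] <-]; rewrite -projN //.
by case: (combSg x Dx) => /projcomb; [left|right].
Qed.

(** A form dual to [Sg] at an element outside [J] vanishes on [span J], so it takes the same value
    on a vector and on its projection. *)
Lemma QRS_dual : exists cf : 'rV[R]_n -> {scalar 'rV[R]_n},
  forall x y, QS x -> QS y -> cf x y = (x == y)%:R.
Proof.
have finJ := fin_J; case: baseSg => _ indep _ _.
have [cf cfE] := lin_indep_dual fin_Sg indep.
(* The preimage [0] chosen outside [QS] is a dummy. *)
have h s : exists y, QS s -> (Sg `\` J) y /\ proj J y = s.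
  by have [[y Sy ys]|nS] := pselect (QS s); [exists y|exists 0].
have [pre preP] := choice h; exists (fun s => cf (pre s)) => s t Ss St.
have [[Sgs nJs] ps] := preP s Ss; have [[Sgt nJt] pt] := preP t St.
have -> : cf (pre s) t = cf (pre s) (pre t).
  apply/eqP; rewrite eq_sym -subr_eq0 -linearB -{2}pt.
  by rewrite (cf_span cfE JSg Sgs nJs (span_subproj finJ _)).
rewrite cfE //; congr (nat_of_bool _)%:R; apply/eqP/eqP => [e|->//].
by rewrite -ps -pt e.
Qed.

(** An element of [Sg] outside [J] is not in [span J], since its own dual form vanishes there. *)
Lemma QRS_simple : QS `<=` QR.
Proof.
case: baseSg => SgD indep _ _; have [cf cfE] := lin_indep_dual fin_Sg indep.
move=> _ [y [Sgy nJy] <-]; exists y => //; split; first exact: SgD.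
move=> /(cf_span cfE JSg Sgy nJy); rewrite cfE // eqxx => /eqP.
by rewrite oner_eq0.
Qed.

End RootSystem.

Theorem theorem3p14 (R : realType) (n : nat) (Rt S Phi : set 'rV[R]_n) :
  is_QRS Rt S -> QRS_connected S -> Phi `<=` pos_roots Rt S ->
  exists I Psi X : set 'rV[R]_n,
    good_decomp Rt S Phi I Psi X /\
    (forall I' Psi' X' : set 'rV[R]_n,
        good_decomp Rt S Phi I' Psi' X' -> [/\ I' = I, Psi' = Psi & X' = X]).
Proof.
move=> [D [Sg [J [rootD baseSg [JSg nJ] -> ->]]]] connS PhiR.
have [sS sSE] : fin_set (proj J @` (Sg `\` J)).
  by apply: fin_set_image; apply: fin_set_sub (fin_Sg rootD baseSg); apply: subDsetl.
have [cf cfE] := QRS_dual rootD baseSg JSg.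
(* The base is nonempty because [J] is proper; an empty one would have no proper subset [I]. *)
have S0 : proj J @` (Sg `\` J) !=set0.
  apply: contrapT => H; apply: nJ; apply/seteqP; split=> // x Sgx.
  by apply: contrapT => nJx; apply: H; exists (proj J x), x.
apply: (@decomp_exists_unique R n _ _ (undup sS) cf) => //.
- exact: undup_uniq.
- by move=> x; rewrite mem_undup.
- exact: QRS_simple.
- exact: QRS_comb.
- exact: (QRS_neq0 rootD baseSg JSg).
- exact: (QRS_opp rootD baseSg JSg).
- exact: (QRS_add rootD baseSg JSg).
Qed.
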